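(* Let $\mathfrak D\subset\mathbb R^{n+1}$ be a domain and let $\psi\in C^3(\mathfrak D;\mathbb R)$ satisfy $\nabla\psi(\boldsymbol r)\neq\mathbf 0$ for all $\boldsymbol r\in\mathfrak D$. Put $F=|\nabla\psi|$ and $V=\Delta\psi$. At each $\boldsymbol r\in\mathfrak D$ let $\mathcal R(\boldsymbol r)$ be the Ricci scalar curvature at $\boldsymbol r$ of the level set of $\psi$ through $\boldsymbol r$, and let $\hat W$ be the Weingarten transform of that level set with respect to the unit normal $\boldsymbol n=-\nabla\psi/|\nabla\psi|$. Then $$\Delta\log F+\mathcal R-\frac{\partial V}{\partial\psi}-\frac{2\operatorname{Tr}(\hat W)V}{F}+\frac{V^{2}}{F^{2}}=\Delta\log F+\mathcal R-F^{2}\frac{\partial}{\partial\psi}\frac{V}{F^{2}}-\frac{V^{2}}{F^{2}}=\Delta\log F+\mathcal R-\nabla\cdot\left(\frac{V\nabla\psi}{F^{2}}\right)=0 .$$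
   Context: $\nabla$, $\nabla\cdot$ and $\Delta$ are the gradient, divergence and Laplacian of the flat ambient space $\mathbb R^{n+1}$ in Cartesian coordinates. Level sets carry the Riemannian metric induced from $\mathbb R^{n+1}$. Curvilinear coordinates: near each point of $\mathfrak D$ one uses local coordinates $(u^0,u^1,\dots,u^n)$, $\boldsymbol r=\boldsymbol r(u^0,\dots,u^n)$, with $u^0=\psi(\boldsymbol r)$ and with $u^1,\dots,u^n$ constant along the integral curves of $\nabla\psi$; thus $\partial\boldsymbol r/\partial u^0=\nabla\psi/F^2=-\boldsymbol n/F$. The symbol $\partial/\partial\psi$ means $\partial/\partial u^0$ with $u^1,\dots,u^n$ held fixed, i.e. $\partial f/\partial\psi=F^{-2}\,\nabla\psi\cdot\nabla f$ for $C^1$ functions $f$ on $\mathfrak D$. Weingarten transform: with Latin indices in $\{1,\dots,n\}$ and $\partial_i=\partial/\partial u^i$, set $g_{ij}=\partial_i\boldsymbol r\cdot\partial_j\boldsymbol r$, $(g^{ij})=(g_{ij})^{-1}$, $b_{ij}=\partial_i\partial_j\boldsymbol r\cdot\boldsymbol n$, $b_i^j=g^{jk}b_{ki}$ (summation convention), and $\hat W=(b_i^j)$; so $\mathrm d\boldsymbol n=-\hat W\,\mathrm d\boldsymbol r$ tangentially. Ricci scalar: $\mathcal R=g^{ij}R_{ij}$ with $R_{ij}=\partial_\ell\Gamma^\ell_{ij}-\partial_j\Gamma^\ell_{i\ell}+\Gamma^\ell_{ij}\Gamma^m_{\ell m}-\Gamma^m_{i\ell}\Gamma^\ell_{jm}$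 the Ricci tensor of the induced metric on the level set (so a round $n$-sphere of radius $r$ has $\mathcal R=n(n-1)/r^2$). *)

(* Defs.v *)
From HB Require Import structures.
From mathcomp Require Import all_boot all_order all_algebra.
From mathcomp Require Import all_classical all_reals all_analysis.

Set Implicit Arguments.
Unset Strict Implicit.
Unset Printing Implicit Defensive.

Import Order.TTheory GRing.Theory Num.Theory.
Import numFieldNormedType.Exports.

Local Open Scope classical_set_scope.
Local Open Scope ring_scope.

(** * Flat calculus on R^m, in Cartesian coordinates *)

Section FlatCalculus.
Context {R : realType} {m : nat}.
Implicit Types (f : 'rV[R]_m -> R) (x : 'rV[R]_m).

Definition partial {V : normedModType R} (i : 'I_m) (f : 'rV[R]_m -> V)
    : 'rV[R]_m -> V :=
  fun x => 'D_(delta_mx 0 i) f x.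

(** [f] is of class C^k on the open set [D]: k times (Frechet) differentiable
    with continuous k-th derivative. *)
Fixpoint classC {V : normedModType R} (k : nat) (D : set 'rV[R]_m)
    (f : 'rV[R]_m -> V) : Prop :=
  match k with
  | 0 => forall x, D x -> {for x, continuous f}
  | k'.+1 => (forall x, D x -> differentiable f x) /\
             (forall i, classC k' D (partial i f))
  end.

(** The library norm [`|x|] on row vectors is the sup norm, hence an explicit
    Euclidean structure. *)
Definition dot (v w : 'rV[R]_m) : R := \sum_(i < m) v 0 i * w 0 i.

Definition enorm (v : 'rV[R]_m) : R := Num.sqrt (dot v v).

Definition gradient f : 'rV[R]_m -> 'rV[R]_m :=
  fun x => \row_i partial i f x.

Definition divergence (v : 'rV[R]_m -> 'rV[R]_m) : 'rV[R]_m -> R :=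
  fun x => \sum_(i < m) partial i (fun y => v y 0 i) x.

Definition laplacian f : 'rV[R]_m -> R := divergence (gradient f).

(** The derivative with respect to [u^0 = psi] along the integral curves of
    the gradient of [psi]: the coordinate vector of [u^0] is
    [grad psi / |grad psi|^2]. *)
Definition dpsi (psi f : 'rV[R]_m -> R) : 'rV[R]_m -> R :=
  fun x => (enorm (gradient psi x) ^+ 2)^-1 *
           dot (gradient psi x) (gradient f x).

(** The unit normal to the level sets, pointing towards decreasing [psi]. *)
Definition unit_normal (psi : 'rV[R]_m -> R) : 'rV[R]_m -> 'rV[R]_m :=
  fun x => - (enorm (gradient psi x))^-1 *: gradient psi x.

End FlatCalculus.

(** * Local coordinates on a level set

    A hypersurface of R^(n+1) is described near a point by a regular
    parametrization [X : U -> R^(n+1)], [U] open in R^n; [X] plays the part of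
    [(u^1, ..., u^n) |-> r(u^0, u^1, ..., u^n)] at a fixed value of [u^0]. *)

(** [X] is a C^3 regular parametrization, defined on [U], of a piece of the
    level set [{x in D | psi x = c}]. Rows of the Jacobian ['J X u] are the
    tangent vectors [partial i X u]. *)
Record level_set_chart {R : realType} {n : nat} (D : set 'rV[R]_n.+1)
    (psi : 'rV[R]_n.+1 -> R) (c : R) (U : set 'rV[R]_n)
    (X : 'rV[R]_n -> 'rV[R]_n.+1) : Prop := LevelSetChart {
  chart_open : open U ;
  chart_C3 : classC 3 U X ;
  chart_dom : forall u, U u -> D (X u) ;
  chart_level : forall u, U u -> psi (X u) = c ;
  chart_regular : forall u, U u -> row_free ('J X u)
}.

Section HypersurfaceGeometry.
Context {R : realType} {n : nat}.
Variable X : 'rV[R]_n -> 'rV[R]_n.+1.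
Implicit Types (i j k l m : 'I_n) (u : 'rV[R]_n).

Definition metric u : 'M[R]_n :=
  \matrix_(i, j) dot (partial i X u) (partial j X u).

Definition inv_metric u : 'M[R]_n := invmx (metric u).

(** [christoffel l i j] is $\Gamma^l_{ij}$. *)
Definition christoffel l i j u : R :=
  2^-1 * \sum_k inv_metric u l k *
    (partial i (fun v => metric v j k) u
     + partial j (fun v => metric v i k) u
     - partial k (fun v => metric v i j) u).

Definition ricci i j u : R :=
  \sum_l partial l (christoffel l i j) u
  - \sum_l partial j (christoffel l i l) u
  + \sum_l \sum_m christoffel l i j u * christoffel m l m u
  - \sum_l \sum_m christoffel m i l u * christoffel l j m u.

Definition ricci_scalar u : R :=
  \sum_i \sum_j inv_metric u i j * ricci i j u.

(** Second fundamental form with respect to the normal [N] at the point of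
    parameter [u]. *)
Definition second_form (N : 'rV[R]_n.+1) u : 'M[R]_n :=
  \matrix_(i, j) dot (partial i (partial j X) u) N.

(** Entry [(i, j)] is $b_i^j = g^{jk} b_{ki}$. *)
Definition weingarten (N : 'rV[R]_n.+1) u : 'M[R]_n :=
  \matrix_(i, j) \sum_k inv_metric u j k * second_form N u k i.

End HypersurfaceGeometry.

(* Main.v *)
Require Import Defs.
From HB Require Import structures.
From mathcomp Require Import all_boot all_order all_algebra.
From mathcomp Require Import all_classical all_reals all_analysis.
From mathcomp Require Import perm ring.

Set Implicit Arguments.
Unset Strict Implicit.
Unset Printing Implicit Defensive.

Import Order.TTheory GRing.Theory Num.Theory.
Import numFieldNormedType.Exports.

Local Open Scope classical_set_scope.
Local Open Scope ring_scope.

(** Let [g] and [H] be the gradient and the Hessian of [psi], and [Q = F^2].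
    In Cartesian coordinates [Delta log F - div (V g / Q)] is the divergence of
    [(H g - V g) / Q]; by symmetry of the third derivatives the third-order
    terms cancel and what is left is
    [(tr H^2 - V^2) / Q - 2 (|H g|^2 - V g.H g) / Q^2].
    Differentiating [psi o X = c] twice shows that the second fundamental form
    of the level set is [H] restricted to the tangent space, divided by [F].
    The Gauss equation [R = (tr W)^2 - tr W^2], with the orthogonal projection
    [1 - g^T g / Q] onto the tangent space, then gives exactly the opposite of
    that expression. *)

(** * Symmetry of mixed derivatives *)

Section MixedDerivatives.
Context {R : realType} {V : normedModType R}.
Implicit Types (f fv fw : V -> R) (D : set V) (x v w a : V).

Lemma is_derive_line f a v (t df : R) : is_derive (t *: v + a) v f df ->
  is_derive t 1 (fun s : R => f (s *: v + a)) df.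
Proof.
case=> + <-; rewrite /derivable /derive => cvf.
have E : (fun h : R => h^-1 *: (((fun s : R => f (s *: v + a)) \o shift t) (h *: 1)
            - f (t *: v + a)))
       = (fun h : R => h^-1 *: ((f \o shift (t *: v + a)) (h *: v)
            - f (t *: v + a))).
  by apply/funext => h /=; rewrite [h *: 1]mulr1 scalerDl addrA.
by apply: DeriveDef; rewrite /derivable /derive E.
Qed.

(* The mean value theorem in direction [v], applied to the increment of [f]
   along [h *: w], turns the second difference into a first difference of the
   derivative [fv]. *)
Lemma second_difference f fv D x v w (e : R) :
  open D -> D x -> (forall y, D y -> is_derive y v f (fv y)) ->
  differentiable fv x -> 0 < e ->
  \forall h \near 0^'+,
    `|f (h *: v + (h *: w + x)) - f (h *: v + x) - f (h *: w + x) + f x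
      - h ^+ 2 * 'D_w fv x| <= e * h ^+ 2.
Proof.
move=> oD Dx df dvf e0; rewrite (deriveE _ dvf).
(* For [0 <= c <= h] both [c *: v] and [c *: v + h *: w] have norm at most [h * M]; the summand 1
   keeps [M] positive when [v] and [w] vanish. Two linearization errors of [fv] will occur, each at
   most [e / (2 * M) * (h * M)], which explains the constant [e / (2 * M)]. *)
set L := 'd _ x; set M := `|v| + `|w| + 1.
have M0 : 0 < M by rewrite ltr_wpDl ?addr_ge0.
have eM0 : 0 < e / (2 * M) by rewrite divr_gt0 ?mulr_gt0.
have : \forall k \near (0 : V), D (k + x) /\
    `|fv (k + x) - fv x - L k| <= e / (2 * M) * `|k|.
  near=> k; split.
    near: k; have := open_nbhs_nbhs (conj oD Dx); rewrite -[nbhs x D]/(\near x, D x).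
    by rewrite (near_shift 0) subr0.
  near: k; have /eqaddoP/(_ _ eM0) := diff_locally dvf.
  by apply: filterS => k /=; rewrite opprD addrA.
move=> /nbhs_ballP[d /= d0 Hd].
have {}Hd k : `|k| < d -> D (k + x) /\
    `|fv (k + x) - fv x - L k| <= e / (2 * M) * `|k|.
  by move=> kd; apply: Hd; rewrite -ball_normE /= sub0r normrN.
near=> h.
have h0 : 0 < h by near: h; exact: nbhs_right_gt.
have hd : h * M < d.
  by rewrite -ltr_pdivlMr//; near: h; apply: nbhs_right_lt; rewrite divr_gt0.
have small (c : R) : c \in `[0, h] ->
   `|c *: v| <= h * M /\ `|c *: v + h *: w| <= h * M.
  rewrite in_itv /= => /andP[c0 ch].
  have cv : `|c *: v| <= h * `|v| by rewrite normrZ ger0_norm// ler_wpM2r.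
  split; first by apply: le_trans cv _; rewrite ler_pM2l// /M -addrA lerDl addr_ge0.
  apply: le_trans (ler_normD _ _) _; rewrite [`|h *: w|]normrZ (gtr0_norm h0).
  by apply: le_trans (lerD cv (lexx _)) _; rewrite -mulrDr ler_pM2l// lerDl.
pose g (t : R) := f (t *: v + (h *: w + x)) - f (t *: v + x).
pose dg (t : R) := fv (t *: v + (h *: w + x)) - fv (t *: v + x).
have gder t : t \in `[0, h] -> is_derive t 1 g (dg t).
  move=> th; have [s1 s2] := small _ th.
  apply: is_deriveB; apply: is_derive_line; apply: df.
    by rewrite addrA; apply: (Hd _ _).1; exact: le_lt_trans hd.
  by apply: (Hd _ _).1; exact: le_lt_trans hd.
have gcont : {within `[0, h], continuous g}.
  by apply: derivable_within_continuous => t th; have [] := gder t th.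
have gder' t : t \in `]0, h[ -> is_derive t 1 g (dg t).
  by move=> th; apply: gder; apply: subset_itv_oo_cc th.
have [c ch gE] := MVT h0 gder' gcont.
have {}ch : c \in `[0, h] by apply: subset_itv_oo_cc ch.
have [s1 s2] := small _ ch.
have [_ b1] := Hd _ (le_lt_trans s1 hd).
have [_ b2] := Hd _ (le_lt_trans s2 hd).
have -> : f (h *: v + (h *: w + x)) - f (h *: v + x) - f (h *: w + x) + f x
    = dg c * h.
  by rewrite -[in dg c * h](subr0 h) -gE /g scale0r !add0r opprB addrA; ring.
(* By linearity [L (c *: v + h *: w) - L (c *: v) = h * L w], so the unknown mean value point [c]
   survives only in the two error terms. *)
have -> : dg c * h - h ^+ 2 * L w = h *
  ((fv (c *: v + h *: w + x) - fv x - L (c *: v + h *: w))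
    - (fv (c *: v + x) - fv x - L (c *: v))).
  have LZ : L (h *: w) = h * L w by exact: linearZ.
  by rewrite linearD LZ /dg addrA; ring.
rewrite normrM (gtr0_norm h0) [e * _]mulrC expr2 -mulrA ler_pM2l//.
apply: le_trans (ler_normB _ _) _.
apply: le_trans (lerD b2 b1) _; rewrite -mulrDr.
apply: le_trans (ler_wpM2l (ltW eM0) (lerD s2 s1)) _.
rewrite -[_ * _]/(e / (2 * M) * (h * M + h * M)).
rewrite le_eqVlt; apply/orP; left; apply/eqP; field.
exact: lt0r_neq0.
Unshelve. all: by end_near. Qed.

(** Both mixed derivatives are approximated by the same second difference divided by [h ^+ 2], since
    that difference is symmetric in [v] and [w]. *)
Lemma derive_comm f fv fw D x v w : open D -> D x ->
  (forall y, D y -> is_derive y v f (fv y)) ->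
  (forall y, D y -> is_derive y w f (fw y)) ->
  differentiable fv x -> differentiable fw x ->
  'D_w fv x = 'D_v fw x.
Proof.
move=> oD Dx dfv dfw dv dw; apply/eqP; rewrite -subr_eq0 -normr_le0.
apply/ler_addgt0Pr => e e0; rewrite add0r.
have e20 : 0 < e / 2 by rewrite divr_gt0.
have Hv := second_difference w oD Dx dfv dv e20.
have Hw := second_difference v oD Dx dfw dw e20.
have [h [h0 [Bv Bw]]] :=
  filter_ex (filterI (nbhs_right_gt (0 : R)) (filterI Hv Hw)).
have h20 : 0 < h ^+ 2 by rewrite exprn_gt0.
have close (p q S A B C : R) : `|S - A - B + C - h ^+ 2 * p| <= e / 2 * h ^+ 2 ->
    `|S - B - A + C - h ^+ 2 * q| <= e / 2 * h ^+ 2 -> `|p - q| <= e.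
  move=> Bp Bq; rewrite -(ler_pM2l h20) -[X in X * `|_|](gtr0_norm h20) -normrM.
  have -> : h ^+ 2 * (p - q) =
    (S - B - A + C - h ^+ 2 * q) - (S - A - B + C - h ^+ 2 * p) by ring.
  apply: le_trans (ler_normB _ _) _; apply: le_trans (lerD Bq Bp) _.
  by rewrite -mulrDl -splitr mulrC.
by apply: close Bv _; rewrite (addrCA (h *: v)); exact: Bw.
Qed.

End MixedDerivatives.

(** * Directional derivatives *)

Section DirectionalDerivatives.
Context {R : realType} {V : normedModType R}.
Implicit Types (D : set V) (x v w : V).

Lemma is_derive_eq_on {W : normedModType R} D (f g : V -> W) x v dg :
  open D -> D x -> (forall y, D y -> f y = g y) ->
  is_derive x v g dg -> is_derive x v f dg.
Proof.
move=> oD Dx fg; apply: near_eq_is_derive; near=> y; apply/esym/fg.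
by near: y; exact: open_nbhs_nbhs.
Unshelve. all: by end_near. Qed.

Lemma is_derive_bigsum {W : normedModType R} n (h : 'I_n -> V -> W) dh x v :
  (forall i, is_derive x v (h i) (dh i)) ->
  is_derive x v (fun y => \sum_i h i y) (\sum_i dh i).
Proof.
move=> H; have -> : (fun y => \sum_i h i y) = \sum_i h i.
  by apply/funext => y; rewrite fct_sumE.
exact: is_derive_sum.
Qed.

Lemma is_derive_mul (f g : V -> R) x v df dg :
  is_derive x v f df -> is_derive x v g dg ->
  is_derive x v (fun y => f y * g y) (df * g x + f x * dg).
Proof.
move=> Hf Hg; rewrite addrC [df * _]mulrC; exact: is_deriveM.
Qed.

Lemma is_derive_coord {p q} (A : V -> 'M[R]_(p, q)) x v dA i j :
  is_derive x v A dA -> is_derive x v (fun y => A y i j) (dA i j).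
Proof.
move=> [cA <-]; rewrite (derive_mx cA) mxE; apply: derivableP.
exact: (derivable_mxP _ _ _).1.
Qed.

Lemma is_derive_mx {p q} (A : V -> 'M[R]_(p, q)) x v (dA : 'M[R]_(p, q)) :
  (forall i j, is_derive x v (fun y => A y i j) (dA i j)) ->
  is_derive x v A dA.
Proof.
move=> H; have cA : derivable A x v by apply/derivable_mxP => i j; have [] := H i j.
apply: DeriveDef => //; rewrite (derive_mx cA); apply/matrixP => i j.
by rewrite mxE; have [] := H i j.
Qed.

Lemma is_derive_dot {m} (A B : V -> 'rV[R]_m) x v dA dB :
  is_derive x v A dA -> is_derive x v B dB ->
  is_derive x v (fun y => dot (A y) (B y)) (dot dA (B x) + dot (A x) dB).
Proof.
move=> HA HB; rewrite /dot -big_split /=; apply: is_derive_bigsum => i.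
by apply: is_derive_mul; exact: is_derive_coord.
Qed.

Lemma differentiable_is_derive {W : normedModType R} (f : V -> W) x v :
  differentiable f x -> is_derive x v f ('D_v f x).
Proof. by move=> df; exact/derivableP/diff_derivable. Qed.

Lemma differentiable_entry {p q} (A : V -> 'M[R]_(p, q)) x i j :
  differentiable A x -> differentiable (fun y => A y i j) x.
Proof.
move=> dA; apply: (@differentiable_comp _ _ _ _ A (fun N : 'M[R]_(p, q) => N i j)) => //.
exact: differentiable_coord.
Qed.

Lemma derive_comm_rV {m} (f : V -> 'rV[R]_m) D x v w :
  open D -> D x -> (forall y, D y -> differentiable f y) ->
  differentiable ('D_v f) x -> differentiable ('D_w f) x ->
  'D_w ('D_v f) x = 'D_v ('D_w f) x.
Proof.
(* Chains of [etrans] instead of [rewrite]: the unifier would otherwise compare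
   the two iterated derivatives by unfolding their limits. *)
move=> oD Dx df dv dw; apply/rowP => a.
have cv := is_derive_coord 0 a (differentiable_is_derive w dv).
have cw := is_derive_coord 0 a (differentiable_is_derive v dw).
refine (etrans (esym (@derive_val _ _ _ _ _ _ _ cv))
  (etrans _ (@derive_val _ _ _ _ _ _ _ cw))).
apply: (@derive_comm _ _ (fun y => f y 0 a) _ _ D) oD Dx _ _ _ _.
- by move=> y Dy; apply/is_derive_coord/differentiable_is_derive/df.
- by move=> y Dy; apply/is_derive_coord/differentiable_is_derive/df.
- exact: differentiable_entry.
- exact: differentiable_entry.
Qed.

Lemma is_derive_comp1 (f : V -> R) (phi : R -> R) x v df dphi :
  differentiable f x -> is_derive x v f df -> is_derive (f x) 1 phi dphi ->
  is_derive x v (phi \o f) (dphi * df).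
Proof.
move=> dfx [_ <-] [/[dup] /derivable1_diffP dph cph <-].
have dc : differentiable (phi \o f) x by exact: differentiable_comp.
apply: DeriveDef; first exact: diff_derivable.
rewrite !deriveE// diff_comp//= deriv1E// derive1E deriveE//.
by rewrite scale1r; exact: mulrC.
Qed.

Lemma is_derive_comp_gradient {m} (X : V -> 'rV[R]_m) (f : 'rV[R]_m -> R) x v :
  differentiable X x -> differentiable f (X x) ->
  is_derive x v (f \o X) (dot (gradient f (X x)) ('D_v X x)).
Proof.
move=> dX df.
have dc : differentiable (f \o X) x by exact: differentiable_comp.
apply: DeriveDef; first exact: diff_derivable.
rewrite !deriveE// diff_comp//= {1}(row_sum_delta ('d X x v)) linear_sum.
apply: eq_bigr => i _; rewrite mxE /partial deriveE// mulrC.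
exact: linearZ.
Qed.

Lemma derivable_prod n (h : 'I_n -> V -> R) x v :
  (forall i, derivable (h i) x v) ->
  derivable (fun y => \prod_i h i y) x v.
Proof.
move=> H; have -> : (fun y => \prod_i h i y) = \prod_i h i.
  by apply/funext => y; rewrite fct_prodE.
apply: (big_ind (fun g => derivable g x v)).
- exact: derivable_cst.
- by move=> f g df dg; exact: derivableM.
- by move=> i _; exact: H.
Qed.

Lemma derivable_det n (A : V -> 'M[R]_n) x v :
  (forall i j, derivable (fun y => A y i j) x v) ->
  derivable (fun y => \det (A y)) x v.
Proof.
move=> H; rewrite /determinant.
rewrite [X in derivable X](_ : _ =
    \sum_s ((-1) ^+ (odd_perm s) \*: (fun y => \prod_i A y i (s i)))); last first.
  by apply/funext => y; rewrite fct_sumE.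
apply: (big_ind (fun g => derivable g x v)).
- exact: derivable_cst.
- by move=> f g df dg; exact: derivableD.
- by move=> s _; apply: derivableZ; exact: derivable_prod.
Qed.

(** By Cramer's rule the inverse is the adjugate over the determinant on [D], and both are
    polynomial in the entries of [A]. *)
Lemma derivable_invmx n (A : V -> 'M[R]_n) D x v i j : open D -> D x ->
  (forall y, D y -> A y \in unitmx) ->
  (forall i j, derivable (fun y => A y i j) x v) ->
  derivable (fun y => invmx (A y) i j) x v.
Proof.
move=> oD Dx uA dA.
have dadj : derivable (fun y => \adj (A y) i j) x v.
  have -> : (fun y => \adj (A y) i j) =
     (-1) ^+ (j + i) \*: (fun y => \det (row' j (col' i (A y)))).
    by apply/funext => y; rewrite mxE.
  apply: derivableZ; apply: derivable_det => k l.
  rewrite (_ : (fun y => _) = fun y => A y (lift j k) (lift i l))//.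
  by apply/funext => y; rewrite !mxE.
have uAx := uA _ Dx.
have ddet : derivable (fun y => (\det (A y))^-1) x v.
  apply: derivableV; first by move: uAx; rewrite unitmxE unitfE.
  exact: derivable_det.
apply: ex_derive; apply: (@is_derive_eq_on _ D
   _ (fun y => (\det (A y))^-1 * \adj (A y) i j)) => //.
  by move=> y Dy; rewrite /invmx uA// mxE.
by apply: is_derive_mul; exact: derivableP.
Qed.

End DirectionalDerivatives.

(** * Contracted Gauss equation *)

Section Dot.
Context {R : realType} {m : nat}.
Implicit Types v w : 'rV[R]_m.

Lemma dotE v w : dot v w = (v *m w^T) 0 0.
Proof. by rewrite mxE; apply: eq_bigr => i _; rewrite mxE. Qed.

Lemma dotC v w : dot v w = dot w v.
Proof. by apply: eq_bigr => i _; rewrite mulrC. Qed.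

Lemma dotZl a v w : dot (a *: v) w = a * dot v w.
Proof. by rewrite /dot mulr_sumr; apply: eq_bigr => i _; rewrite mxE mulrA. Qed.

Lemma dotZr a v w : dot v (a *: w) = a * dot v w.
Proof. by rewrite dotC dotZl dotC. Qed.

Lemma dot0r v : dot v 0 = 0.
Proof. by rewrite /dot big1// => i _; rewrite mxE mulr0. Qed.

Lemma dot_suml n (f : 'I_n -> 'rV[R]_m) w :
  dot (\sum_i f i) w = \sum_i dot (f i) w.
Proof.
rewrite /dot exchange_big; apply: eq_bigr => i _.
by rewrite summxE mulr_suml.
Qed.

Lemma dot_ge0 v : 0 <= dot v v.
Proof. by apply: sumr_ge0 => i _; rewrite -expr2 sqr_ge0. Qed.

Lemma dot_eq0 v : (dot v v == 0) = (v == 0).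
Proof.
apply/idP/eqP => [|->]; last by rewrite /dot big1// => i _; rewrite mxE mul0r.
rewrite psumr_eq0 => [/allP v0|i _]; last by rewrite -expr2 sqr_ge0.
apply/rowP => i; have := v0 i (mem_index_enum i).
by rewrite mxE /= mulf_eq0 orbb => /eqP.
Qed.

End Dot.

Section ContractedGauss.
Context {R : realFieldType} {n : nat}.
Implicit Types (i j k l m : 'I_n).

(** Pure algebra at one point: [T] stands for the tangential components of the third derivatives of
    the parametrization, [G] for the inverse metric and [B] for the second fundamental form. In the
    Ricci contraction the [T] terms cancel by their symmetry, the products of Christoffel symbols
    cancel in pairs, and only the terms in [B] remain. *)
Lemma contracted_gauss (Gam : 'I_n -> 'I_n -> 'I_n -> R)
    (dGam T : 'I_n -> 'I_n -> 'I_n -> 'I_n -> R) (G B : 'M[R]_n) i j :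
  (forall l i j, Gam l i j = Gam l j i) -> B^T = B ->
  (forall l, T l l i j = T j l i l) ->
  (forall m l i j, dGam m l i j = T m l i j
     + (- (\sum_p Gam l m p * Gam p i j) + (\sum_k G l k * B m k) * B i j)) ->
  \sum_l dGam l l i j - \sum_l dGam j l i l
   + \sum_l \sum_m Gam l i j * Gam m l m
   - \sum_l \sum_m Gam m i l * Gam l j m
  = (\tr (G *m B) *: B - B *m G *m B) i j.
Proof.
move=> Gsym Bsym Tsym dE.
have Bs a b : B a b = B b a by rewrite -[in LHS]Bsym mxE.
rewrite (eq_bigr _ (fun l _ => dE l l i j)) (eq_bigr _ (fun l _ => dE j l i l)).
rewrite !big_split /= !sumrN.
have -> : \sum_l T l l i j = \sum_l T j l i l by apply: eq_bigr.
have -> : \sum_l \sum_m Gam l i j * Gam m l m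
    = \sum_l \sum_p Gam l l p * Gam p i j.
  rewrite exchange_big; apply: eq_bigr => l _; apply: eq_bigr => p _.
  by rewrite mulrC Gsym.
have -> : \sum_l \sum_m Gam m i l * Gam l j m
    = \sum_l \sum_p Gam l j p * Gam p i l.
  by apply: eq_bigr => l _; apply: eq_bigr => p _; rewrite mulrC.
have -> : \sum_l (\sum_k G l k * B l k) * B i j = (\tr (G *m B) *: B) i j.
  rewrite mxE mulr_suml; apply: eq_bigr => l _; congr (_ * _).
  by rewrite mxE; apply: eq_bigr => k _; rewrite [B k l]Bs.
have -> : \sum_l (\sum_k G l k * B j k) * B i l = (B *m G *m B) i j.
  rewrite -mulmxA mxE; apply: eq_bigr => l _; rewrite mulrC; congr (_ * _).
  by rewrite mxE; apply: eq_bigr => k _; rewrite [B k j]Bs.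
rewrite !mxE; ring.
Qed.

(** The contraction of the Ricci tensor to the scalar curvature; symmetry of [M] turns the double
    sum into a trace. *)
Lemma trace_gauss (G B : 'M[R]_n) : G^T = G -> B^T = B ->
  \sum_i \sum_j G i j * (\tr (G *m B) *: B - B *m G *m B) i j
  = \tr (G *m B) ^+ 2 - \tr ((G *m B) *m (G *m B)).
Proof.
move=> Gs Bs; set M := _ - _.
have Ms : M^T = M.
  by rewrite /M linearB /= linearZ /= !trmx_mul Gs Bs mulmxA.
have -> : \sum_i \sum_j G i j * M i j = \tr (G *m M).
  apply: eq_bigr => i _; rewrite mxE; apply: eq_bigr => j _.
  by rewrite -[in LHS]Ms mxE.
rewrite /M mulmxBr linearB /= -scalemxAr linearZ /= expr2; congr (_ - \tr _).
by rewrite !mulmxA.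
Qed.

End ContractedGauss.

(** * Gauss equation of a parametrized hypersurface *)

Section GaussEquation.
Context {R : realType} {n : nat}.
Variables (U : set 'rV[R]_n) (X : 'rV[R]_n -> 'rV[R]_n.+1).
Hypothesis U_open : open U.
Hypothesis X_C3 : classC 3 U X.
Hypothesis metric_unit : forall u, U u -> metric X u \in unitmx.
Implicit Types (i j k l m p : 'I_n) (u : 'rV[R]_n).

Let dX1 u : U u -> differentiable X u.
Proof. by case: X_C3 => dX _; exact: dX. Qed.

Let dX2 i u : U u -> differentiable (partial i X) u.
Proof. by case: X_C3 => _ /(_ i) [d2 _]; exact: d2. Qed.

Let dX3 i j u : U u -> differentiable (partial i (partial j X)) u.
Proof. by case: X_C3 => _ /(_ j) [_ /(_ i) [d3 _]]; exact: d3. Qed.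

Let tangentD i j u : U u ->
  is_derive u (delta_mx 0 i) (partial j X) (partial i (partial j X) u).
Proof. by move=> Uu; exact/differentiable_is_derive/dX2. Qed.

Let hessianD m i j u : U u ->
  is_derive u (delta_mx 0 m) (partial i (partial j X))
    (partial m (partial i (partial j X)) u).
Proof. by move=> Uu; exact/differentiable_is_derive/dX3. Qed.

Lemma partial2C i j u : U u ->
  partial i (partial j X) u = partial j (partial i X) u.
Proof.
move=> Uu; apply: (derive_comm_rV U_open Uu dX1); exact: dX2.
Qed.

(** The transposition of the outermost and innermost indices is composed of an inner swap, an outer
    swap and another inner swap. This is the symmetry that [contracted_gauss] asks of [T]. *)
Lemma partial3C l i j u : U u ->
  partial l (partial i (partial j X)) u = partial j (partial i (partial l X)) u.
Proof.
move=> Uu.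
have inner a b c : partial a (partial b (partial c X)) u
    = partial a (partial c (partial b X)) u.
  apply: near_eq_derive; near=> y; apply: partial2C.
  by near: y; exact: open_nbhs_nbhs.
rewrite inner (inner j); apply: (derive_comm_rV U_open Uu (dX2 i)); exact: dX3.
Unshelve. all: by end_near. Qed.

Lemma metric_sym u : (metric X u)^T = metric X u.
Proof. by apply/matrixP => i j; rewrite !mxE dotC. Qed.

Lemma inv_metric_sym u : (inv_metric X u)^T = inv_metric X u.
Proof. by rewrite /inv_metric trmx_inv metric_sym. Qed.

Let metricD k i j u : U u ->
  is_derive u (delta_mx 0 k) (fun v => metric X v i j)
    (dot (partial k (partial i X) u) (partial j X u)
     + dot (partial i X u) (partial k (partial j X) u)).
Proof.
move=> Uu; apply: (is_derive_eq_on U_open Uu (fun y _ => mxE _ _ _ _) _).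
by apply: is_derive_dot; exact: tangentD.
Qed.

(** The basis of the tangent space dual to the coordinate vectors, that is, the coordinate vectors
    with raised index. *)
Definition dual_tangent l u : 'rV[R]_n.+1 :=
  \sum_k inv_metric X u l k *: partial k X u.

Let inv_metricD m l k u : U u -> is_derive u (delta_mx 0 m)
  (fun v => inv_metric X v l k) (partial m (fun v => inv_metric X v l k) u).
Proof.
move=> Uu; apply: derivableP.
apply: (@derivable_invmx _ _ _ (metric X) U) => //.
by move=> i j; have [] := metricD m i j Uu.
Qed.

Let dualD m l u : U u -> is_derive u (delta_mx 0 m) (dual_tangent l)
  (partial m (dual_tangent l) u).
Proof.
move=> Uu; apply: derivableP; apply/derivable_mxP => z a.
rewrite ord1 (_ : (fun _ => _) =
  fun v => \sum_k inv_metric X v l k * partial k X v 0 a); last first.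
  by apply/funext => v; rewrite summxE; apply: eq_bigr => k _; rewrite mxE.
apply: ex_derive; apply: is_derive_bigsum => k; apply: is_derive_mul.
  exact: inv_metricD.
by apply: is_derive_coord; exact: tangentD.
Qed.

Lemma dot_dual_tangent l p u : U u ->
  dot (dual_tangent l u) (partial p X u) = (l == p)%:R.
Proof.
move=> Uu; rewrite dot_suml.
have := mulVmx (metric_unit Uu) => /matrixP /(_ l p); rewrite !mxE => <-.
by apply: eq_bigr => k _; rewrite dotZl !mxE.
Qed.

(** The Kronecker delta in [dot_dual_tangent] is constant, so the product rule makes the two terms
    cancel. *)
Lemma dot_partial_dual_tangent m l p u : U u ->
  dot (partial m (dual_tangent l) u) (partial p X u)
  = - dot (dual_tangent l u) (partial m (partial p X) u).
Proof.
move=> Uu; apply/eqP; rewrite -subr_eq0 opprK; apply/eqP.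
have := is_derive_dot (dualD m l Uu) (tangentD m p Uu).
move=> H; refine (etrans (esym (@derive_val _ _ _ _ _ _ _ H)) _).
apply: derive_val; apply: (is_derive_eq_on U_open Uu _ (is_derive_cst _ _ _)).
by move=> y Uy; exact: dot_dual_tangent.
Qed.

Lemma dot_partial_dual_normal m l (N : 'rV[R]_n.+1) u : U u ->
  (forall k, dot (partial k X u) N = 0) ->
  dot (partial m (dual_tangent l) u) N
  = \sum_k inv_metric X u l k * dot (partial m (partial k X) u) N.
Proof.
move=> Uu XN.
have H := is_derive_dot (dualD m l Uu) (is_derive_cst N u _).
have -> : dot (partial m (dual_tangent l) u) N =
  dot (partial m (dual_tangent l) u) N + dot (dual_tangent l u) 0.
  by rewrite dot0r addr0.
refine (etrans (esym (@derive_val _ _ _ _ _ _ _ H)) _).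
apply: derive_val.
apply: (is_derive_eq_on U_open Uu (fun y _ => dot_suml _ _) _).
apply: is_derive_bigsum => k.
apply: (is_derive_eq_on U_open Uu (fun y _ => dotZl _ _ _) _).
have := is_derive_mul (inv_metricD m l k Uu)
  (is_derive_dot (tangentD m k Uu) (is_derive_cst N u _)).
move=> HH; apply: (is_derive_eq HH).
(* The derivative of the inverse metric, whose value is left implicit, is multiplied by
   [dot (partial k X u) N = 0]. The vector [N] is held constant and is normal at [u] only. *)
by rewrite (XN k) mulr0 dot0r addr0 add0r.
Qed.

(** Each derivative of the metric splits into two terms; symmetry of second derivatives cancels four
    of the six and makes the remaining two equal, which absorbs the factor [2^-1]. *)
Lemma christoffelE l i j u : U u ->
  christoffel X l i j u = dot (dual_tangent l u) (partial i (partial j X) u).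
Proof.
move=> Uu; rewrite /christoffel dot_suml mulr_sumr; apply: eq_bigr => k _.
have koszul (g q1 q2 q3 a a' b b' c c' : R) : q1 = a + b -> q2 = a' + c ->
    q3 = b' + c' -> a' = a -> b' = b -> c' = c ->
    2^-1 * (g * (q1 + q2 - q3)) = g * a.
  by move=> -> -> -> -> -> ->; field.
rewrite dotZl [in RHS]dotC.
apply: koszul.
- exact: (@derive_val _ _ _ _ _ _ _ (metricD i j k Uu)).
- exact: (@derive_val _ _ _ _ _ _ _ (metricD j i k Uu)).
- exact: (@derive_val _ _ _ _ _ _ _ (metricD k i j Uu)).
- by apply: (congr1 (dot^~ _)); exact: partial2C.
- by refine (etrans (dotC _ _) _); apply: (congr1 (dot _)); exact: partial2C.
- by apply: (congr1 (dot _)); exact: partial2C.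
Qed.

Lemma christoffelC l i j u : U u -> christoffel X l i j u = christoffel X l j i u.
Proof.
move=> Uu; refine (etrans (christoffelE _ _ _ Uu) _).
refine (etrans _ (esym (christoffelE _ _ _ Uu))).
by apply: (congr1 (dot _)); exact: partial2C.
Qed.

Section AtPoint.
Variables (u : 'rV[R]_n) (N : 'rV[R]_n.+1).
Hypothesis Uu : U u.
Hypothesis N_normal : forall k, dot (partial k X u) N = 0.
Hypothesis frame : forall v w : 'rV[R]_n.+1, dot v w =
  \sum_p dot v (partial p X u) * dot (dual_tangent p u) w + dot v N * dot N w.

(** The product rule is applied to the form given by [christoffelE]. The term with the derivative of
    the dual vector is split by [frame]: its tangential part yields products of Christoffel symbols,
    its normal part the product of second fundamental forms. *)
Lemma partial_christoffel m l i j :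
  partial m (christoffel X l i j) u =
  dot (dual_tangent l u) (partial m (partial i (partial j X)) u)
  + (- (\sum_p christoffel X l m p u * christoffel X p i j u)
     + (\sum_k inv_metric X u l k * second_form X N u m k) * second_form X N u i j).
Proof.
have H := is_derive_dot (dualD m l Uu) (hessianD m i j Uu).
have H' : is_derive u (delta_mx 0 m) (christoffel X l i j) _ :=
  is_derive_eq_on U_open Uu (fun y Uy => christoffelE l i j Uy) H.
refine (etrans (@derive_val _ _ _ _ _ _ _ H') _).
refine (etrans (addrC _ _) _); apply: (congr1 (+%R _)).
refine (etrans (frame _ _) _).
rewrite -sumrN; congr (_ + _ * _).
- apply: eq_bigr => p _.
  refine (etrans (congr1 ( *%R^~ _) (dot_partial_dual_tangent _ _ _ Uu)) _).
  refine (etrans (mulNr _ _) _); apply: (congr1 -%R).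
  by apply: congr2; apply/esym; exact: christoffelE.
- refine (etrans (dot_partial_dual_normal _ _ Uu N_normal) _).
  by apply: eq_bigr => k _; rewrite mxE.
- by rewrite mxE dotC.
Qed.

Lemma second_form_sym : (second_form X N u)^T = second_form X N u.
Proof.
apply/matrixP => i j; rewrite !mxE.
by apply: (congr1 (dot^~ _)); exact: partial2C.
Qed.

Lemma weingartenE :
  weingarten X N u = (inv_metric X u *m second_form X N u)^T.
Proof. by apply/matrixP => i j; rewrite !mxE; apply: eq_bigr => k _. Qed.

Theorem gauss_equation : ricci_scalar X u =
  \tr (weingarten X N u) ^+ 2 - \tr (weingarten X N u *m weingarten X N u).
Proof.
rewrite weingartenE -trmx_mul !mxtrace_tr.
rewrite -(trace_gauss (inv_metric_sym u) second_form_sym).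
apply: eq_bigr => i _; apply: eq_bigr => j _; apply: (congr1 ( *%R _)).
apply: (@contracted_gauss _ _ (fun l i j => christoffel X l i j u)
  (fun m l i j => partial m (christoffel X l i j) u)
  (fun m l i j => dot (dual_tangent l u) (partial m (partial i (partial j X)) u))).
- by move=> *; exact: christoffelC.
- exact: second_form_sym.
- by move=> l; apply: (congr1 (dot _)); exact: partial3C.
- by move=> *; exact: partial_christoffel.
Qed.

End AtPoint.

End GaussEquation.

(** * Traces in an adapted frame *)

Section AdaptedFrame.
Context {R : realFieldType} {n : nat}.
Implicit Types (J : 'M[R]_(n, n.+1)) (N : 'rV[R]_n.+1) (H : 'M[R]_n.+1).

(** Stacking [N] on [J] gives a square matrix [M] whose Gram matrix is block diagonal, so [M^T *m S]
    is a right inverse. It is then also a left inverse, and the product in that order is the claimed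
    resolution of the identity. *)
Lemma adapted_frame J N : J *m J^T \in unitmx -> N *m N^T = 1%:M ->
  J *m N^T = 0 -> J^T *m invmx (J *m J^T) *m J + N^T *m N = 1%:M.
Proof.
move=> uJ NN JN; have NJ : N *m J^T = 0 by rewrite -[LHS]trmxK trmx_mul trmxK JN trmx0.
pose M : 'M[R]_(1 + n, n.+1) := col_mx N J.
pose S : 'M[R]_(1 + n) := block_mx 1%:M 0 0 (invmx (J *m J^T)).
have : M *m (M^T *m S) = 1%:M.
  rewrite mulmxA /M tr_col_mx mul_col_row NN NJ JN mulmx_block.
  by rewrite !mul0mx !mulmx0 !addr0 !add0r mul1mx mulmxV// -scalar_mx_block.
move/mulmx1C => <-; rewrite /M /S tr_col_mx mul_row_block !mulmx0 addr0 add0r.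
by rewrite mulmx1 mul_row_col addrC.
Qed.

(** Cyclicity of the trace brings [J^T *m G *m J] together, which is the orthogonal projection
    [1 - N^T *m N] onto the tangent space. *)
Lemma trace_compression J N (G : 'M[R]_n) H :
  J^T *m G *m J + N^T *m N = 1%:M ->
  \tr (G *m (J *m H *m J^T)) = \tr H - (N *m H *m N^T) 0 0.
Proof.
move=> JN; have {}JN : J^T *m G *m J = 1%:M - N^T *m N by rewrite -JN addrK.
have -> : \tr (G *m (J *m H *m J^T)) = \tr (J^T *m G *m J *m H).
  by rewrite !mulmxA mxtrace_mulC !mulmxA.
rewrite JN mulmxBl mul1mx linearB /=; congr (_ - _).
by rewrite -[N^T *m N *m H]mulmxA mxtrace_mulC trace_mx11.
Qed.

Lemma trace_compression2 J N (G : 'M[R]_n) H :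
  J^T *m G *m J + N^T *m N = 1%:M ->
  \tr ((G *m (J *m H *m J^T)) *m (G *m (J *m H *m J^T)))
  = \tr (H *m H) - 2 * (N *m H *m H *m N^T) 0 0 + (N *m H *m N^T) 0 0 ^+ 2.
Proof.
move=> JN; have {}JN : J^T *m G *m J = 1%:M - N^T *m N by rewrite -JN addrK.
have -> : \tr ((G *m (J *m H *m J^T)) *m (G *m (J *m H *m J^T)))
    = \tr ((J^T *m G *m J *m H) *m (J^T *m G *m J *m H)).
  by rewrite -!mulmxA mxtrace_mulC -!mulmxA mxtrace_mulC -!mulmxA
    mxtrace_mulC -!mulmxA.
rewrite JN mulmxBl mul1mx mulmxBl !mulmxBr !linearB /=.
have cyc (A : 'M[R]_(n.+1, 1)) (B : 'rV[R]_n.+1) : \tr (A *m B) = (B *m A) 0 0.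
  by rewrite mxtrace_mulC trace_mx11.
have -> : \tr (H *m (N^T *m N *m H)) = (N *m H *m H *m N^T) 0 0.
  by rewrite mxtrace_mulC -!mulmxA cyc -!mulmxA.
have -> : \tr (N^T *m N *m H *m H) = (N *m H *m H *m N^T) 0 0.
  by rewrite -!mulmxA cyc -!mulmxA.
have -> : \tr (N^T *m N *m H *m (N^T *m N *m H)) = (N *m H *m N^T) 0 0 ^+ 2.
  have -> : N^T *m N *m H *m (N^T *m N *m H)
      = N^T *m ((N *m H *m N^T) *m (N *m H)) by rewrite !mulmxA.
  by rewrite cyc -mulmxA [N *m H *m N^T]mx11_scalar !mul_scalar_mx !mxE eqxx mulr1n expr2.
ring.
Qed.

End AdaptedFrame.

(** * Second-order calculus of the gradient *)

Section LogGradient.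
Context {R : realType} {m : nat}.
Variables (D : set 'rV[R]_m) (psi : 'rV[R]_m -> R).
Hypothesis D_open : open D.
Hypothesis psi_C3 : classC 3 D psi.
Hypothesis psi_regular : forall x, D x -> gradient psi x != 0.
Implicit Types (i j k : 'I_m) (x y : 'rV[R]_m).

Let d1 x : D x -> differentiable psi x.
Proof. by case: psi_C3 => d _; exact: d. Qed.

Let d2 i x : D x -> differentiable (partial i psi) x.
Proof. by case: psi_C3 => _ /(_ i) [d _]; exact: d. Qed.

Let d3 i j x : D x -> differentiable (partial i (partial j psi)) x.
Proof. by case: psi_C3 => _ /(_ j) [_ /(_ i) [d _]]; exact: d. Qed.

Let pD i j x : D x ->
  is_derive x (delta_mx 0 i) (partial j psi) (partial i (partial j psi) x).
Proof. by move=> Dx; exact/differentiable_is_derive/d2. Qed.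

Let hD i j k x : D x ->
  is_derive x (delta_mx 0 i) (partial j (partial k psi))
    (partial i (partial j (partial k psi)) x).
Proof. by move=> Dx; exact/differentiable_is_derive/d3. Qed.

Lemma hessianC i j x : D x ->
  partial i (partial j psi) x = partial j (partial i psi) x.
Proof.
move=> Dx; apply: (derive_comm D_open Dx _ _ (d2 _ Dx) (d2 _ Dx)) => y Dy;
  exact/differentiable_is_derive/d1.
Qed.

(* The gradient of [psi] applied to its Hessian, i.e. half the gradient of
   [|grad psi|^2]. *)
Definition hess_grad i x : R := \sum_j partial j psi x * partial i (partial j psi) x.

Definition sqgrad x : R := dot (gradient psi x) (gradient psi x).

Lemma sqgradE x : sqgrad x = \sum_i partial i psi x * partial i psi x.
Proof. by apply: eq_bigr => i _; rewrite mxE. Qed.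

Lemma sqr_enorm_gradient x : enorm (gradient psi x) ^+ 2 = sqgrad x.
Proof. by rewrite sqr_sqrtr// dot_ge0. Qed.

Lemma sqgrad_gt0 x : D x -> 0 < sqgrad x.
Proof. by move=> Dx; rewrite lt0r dot_ge0 dot_eq0 psi_regular. Qed.

Lemma is_derive_sqgrad i x : D x ->
  is_derive x (delta_mx 0 i) sqgrad (2 * hess_grad i x).
Proof.
move=> Dx; rewrite (funext sqgradE) mulr_sumr; apply: is_derive_bigsum => j.
apply: (is_derive_eq (is_derive_mul (pD i j Dx) (pD i j Dx))).
rewrite [X in X + _]mulrC; set t := _ * _; ring.
Qed.

Lemma differentiable_sqgrad x : D x -> differentiable sqgrad x.
Proof.
move=> Dx; rewrite (funext sqgradE).
rewrite (_ : (fun y => _) = \sum_i (partial i psi * partial i psi)); last first.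
  by apply/funext => y; rewrite fct_sumE.
by apply: differentiable_sum => i; apply: differentiableM; exact: d2.
Qed.

Lemma is_derive_sqgradV i x : D x ->
  is_derive x (delta_mx 0 i) (fun y => (sqgrad y)^-1)
    (- (2 * hess_grad i x) / sqgrad x ^+ 2).
Proof.
move=> Dx; have [c dE] := is_derive_sqgrad i Dx.
have Q0 : sqgrad x != 0 by rewrite gt_eqF// sqgrad_gt0.
apply: DeriveDef; first exact: derivableV.
by rewrite deriveV// dE -[LHS]/(- _ * _) !mulNr mulrC.
Qed.

Lemma is_derive_log_enorm i x : D x ->
  is_derive x (delta_mx 0 i) (fun y => ln (enorm (gradient psi y)))
    (hess_grad i x / sqgrad x).
Proof.
move=> Dx; have Q0 := sqgrad_gt0 Dx.
(* Writing [ln F] as half of [ln (F ^+ 2)] avoids differentiating the square root. *)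
apply: (@is_derive_eq_on _ _ _ D _ (fun y => 2^-1 * (ln (R := R) \o sqgrad) y)) => //.
  move=> y Dy; rewrite /= -sqr_enorm_gradient lnXn ?sqrtr_gt0 ?sqgrad_gt0//.
  by move: (ln _) => t; field.
have H := is_derive_comp1 (differentiable_sqgrad Dx) (is_derive_sqgrad i Dx)
  (is_derive1_ln Q0).
apply: (is_derive_eq (is_derive_mul (is_derive_cst _ _ _) H)).
rewrite mul0r add0r -[LHS]/(2^-1 * ((sqgrad x)^-1 * (2 * hess_grad i x))).
by field; exact: lt0r_neq0.
Qed.

Lemma is_derive_hess_grad i j x : D x ->
  is_derive x (delta_mx 0 i) (hess_grad j)
    (\sum_k (partial i (partial k psi) x * partial j (partial k psi) x
       + partial k psi x * partial i (partial j (partial k psi)) x)).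
Proof.
by move=> Dx; apply: is_derive_bigsum => k; apply: is_derive_mul;
  [exact: pD | exact: hD].
Qed.

Lemma laplacianE : laplacian psi = fun x => \sum_j partial j (partial j psi) x.
Proof.
apply/funext => x; apply: eq_bigr => j _; congr (partial j _ x).
by apply/funext => y; rewrite mxE.
Qed.

Lemma is_derive_laplacian i x : D x ->
  is_derive x (delta_mx 0 i) (laplacian psi)
    (\sum_j partial i (partial j (partial j psi)) x).
Proof.
by move=> Dx; rewrite laplacianE; apply: is_derive_bigsum => j; exact: hD.
Qed.

Lemma dot_gradient_laplacian x : D x ->
  dot (gradient psi x) (gradient (laplacian psi) x)
  = \sum_i partial i psi x * \sum_j partial i (partial j (partial j psi)) x.
Proof.
move=> Dx; apply: eq_bigr => i _; rewrite !mxE; apply: (congr1 ( *%R _)).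
by apply: derive_val; exact: is_derive_laplacian.
Qed.

Lemma laplacian_log_enorm x : D x ->
  laplacian (fun y => ln (enorm (gradient psi y))) x
  = (\sum_i \sum_k partial i (partial k psi) x ^+ 2
      + dot (gradient psi x) (gradient (laplacian psi) x)) / sqgrad x
    - 2 * (\sum_i hess_grad i x ^+ 2) / sqgrad x ^+ 2.
Proof.
move=> Dx; rewrite dot_gradient_laplacian//.
have key i : partial i (fun y => gradient (fun z => ln (enorm (gradient psi z))) y 0 i) x
  = (\sum_k (partial i (partial k psi) x ^+ 2
       + partial k psi x * partial i (partial i (partial k psi)) x)) / sqgrad x
    - 2 * hess_grad i x ^+ 2 / sqgrad x ^+ 2.
  apply: derive_val.
  apply: (@is_derive_eq_on _ _ _ D _ (fun y => hess_grad i y * (sqgrad y)^-1)) => //.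
    by move=> y Dy; rewrite mxE; apply: derive_val; exact: is_derive_log_enorm.
  apply: (is_derive_eq (is_derive_mul (is_derive_hess_grad i i Dx) (is_derive_sqgradV i Dx))).
  under eq_bigr do rewrite -expr2.
  by move: (\sum_k _) (hess_grad i x) (sqgrad x) => a b c; ring.
rewrite /laplacian /divergence (eq_bigr _ (fun i _ => key i)).
rewrite sumrB -!mulr_suml -mulr_sumr; congr (_ / _ - _).
under eq_bigr do rewrite big_split.
rewrite big_split; congr (_ + _).
(* What remains is to move the index [k] outermost in the third derivatives, which turns their sum
   into the derivative of the Laplacian: first the inner pair is swapped near [x], then the outer
   pair at [x]. *)
rewrite exchange_big; apply: eq_bigr => k _; rewrite mulr_sumr.
apply: eq_bigr => i _; apply: (congr1 ( *%R _)).
refine (etrans _ (derive_comm D_open Dx _ _ (d3 _ _ Dx) (d3 _ _ Dx))).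
  apply: near_eq_derive; near=> y; apply: hessianC.
  by near: y; exact: open_nbhs_nbhs.
- by move=> y Dy; exact/differentiable_is_derive/d2.
- by move=> y Dy; exact/differentiable_is_derive/d2.
Unshelve. all: by end_near. Qed.

Let is_derive_laplacian_sqgrad i x : D x ->
  is_derive x (delta_mx 0 i) (fun y => laplacian psi y / enorm (gradient psi y) ^+ 2)
    (gradient (laplacian psi) x 0 i / sqgrad x
      - 2 * laplacian psi x * hess_grad i x / sqgrad x ^+ 2).
Proof.
move=> Dx; apply: (is_derive_eq_on D_open Dx
    (fun y _ => congr1 (fun c => _ / c) (sqr_enorm_gradient y))).
have H := is_derive_laplacian i Dx; have E := derive_val (is_derive := H).
rewrite mxE [partial i _ x]E.
apply: (is_derive_eq (is_derive_mul H (is_derive_sqgradV i Dx))).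
by move: (\sum_j _) (hess_grad i x) (sqgrad x) => a b c; ring.
Qed.

Lemma dpsi_laplacian_sqgrad x : D x ->
  dpsi psi (fun y => laplacian psi y / enorm (gradient psi y) ^+ 2) x
  = (dot (gradient psi x) (gradient (laplacian psi) x) / sqgrad x
     - 2 * laplacian psi x * (\sum_i partial i psi x * hess_grad i x)
       / sqgrad x ^+ 2) / sqgrad x.
Proof.
move=> Dx; rewrite /dpsi sqr_enorm_gradient mulrC; congr (_ / _).
rewrite /dot [X in X - _]mulr_suml [X in _ - X]mulrAC [X in _ - X]mulr_sumr -sumrB.
apply: eq_bigr => i _.
have H := is_derive_laplacian_sqgrad i Dx; have E := derive_val (is_derive := H).
refine (etrans (congr1 ( *%R _) (etrans (mxE _ _ _ _) E)) _).
rewrite [gradient psi x 0 i]mxE.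
by move: (gradient (laplacian psi) x 0 i) (partial i psi x) (hess_grad i x)
  (sqgrad x) (laplacian psi x) => b a c d e; ring.
Qed.

(** The product rule gives the derivative of [V / F ^+ 2] along the gradient, as in
    [dpsi_laplacian_sqgrad] up to the factor [F ^+ 2], plus [V / F ^+ 2] times the divergence of the
    gradient, which is [V] again. *)
Lemma divergence_laplacian_sqgrad x : D x ->
  divergence (fun y => (laplacian psi y / enorm (gradient psi y) ^+ 2) *: gradient psi y) x
  = (dot (gradient psi x) (gradient (laplacian psi) x) / sqgrad x
     - 2 * laplacian psi x * (\sum_i partial i psi x * hess_grad i x)
       / sqgrad x ^+ 2) + laplacian psi x ^+ 2 / sqgrad x.
Proof.
move=> Dx; rewrite /dot [X in X - _ + _]mulr_suml.
rewrite [X in _ - X + _]mulrAC [X in _ - X + _]mulr_sumr -sumrB.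
have -> : laplacian psi x ^+ 2 / sqgrad x
    = \sum_i laplacian psi x / sqgrad x * partial i (partial i psi) x.
  have lapx : laplacian psi x = \sum_j partial j (partial j psi) x.
    by rewrite laplacianE.
  by rewrite -mulr_sumr -lapx expr2 mulrAC.
rewrite -big_split.
apply: eq_bigr => i _; apply: derive_val.
apply: (is_derive_eq_on D_open Dx
  (g := fun y => laplacian psi y / enorm (gradient psi y) ^+ 2 * partial i psi y)).
  by move=> y _; rewrite !mxE.
apply: (is_derive_eq (is_derive_mul (is_derive_laplacian_sqgrad i Dx) (pD i i Dx))).
rewrite sqr_enorm_gradient [gradient psi x 0 i]mxE.
move: (partial i (partial i psi) x) (partial i psi x) => a' a.
by move: (gradient (laplacian psi) x 0 i) (hess_grad i x)
  (sqgrad x) (laplacian psi x) => b c d e /=; ring.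
Qed.

End LogGradient.

(** * Geometry of a level set *)

Section LevelSetChart.
Context {R : realType} {n : nat}.
Variables (D : set 'rV[R]_n.+1) (psi : 'rV[R]_n.+1 -> R) (c : R).
Variables (U : set 'rV[R]_n) (X : 'rV[R]_n -> 'rV[R]_n.+1).
Hypothesis D_open : open D.
Hypothesis psi_C3 : classC 3 D psi.
Hypothesis psi_regular : forall x, D x -> gradient psi x != 0.
Hypothesis X_chart : level_set_chart D psi c U X.
Implicit Types (i j : 'I_n) (u : 'rV[R]_n).

Let U_open : open U := chart_open X_chart.
Let X_C3 : classC 3 U X := chart_C3 X_chart.
Let D_X u : U u -> D (X u) := @chart_dom _ _ _ _ _ _ _ X_chart u.

Let dX u : U u -> differentiable X u.
Proof. by case: X_C3 => d _; exact: d. Qed.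

Let tangentD i j u : U u ->
  is_derive u (delta_mx 0 i) (partial j X) (partial i (partial j X) u).
Proof.
move=> Uu; apply: differentiable_is_derive.
by case: X_C3 => _ /(_ j) [d _]; exact: d.
Qed.

Definition tangent_mx u : 'M[R]_(n, n.+1) := \matrix_(i, a) partial i X u 0 a.

Lemma jacobianE u : U u -> 'J X u = tangent_mx u.
Proof.
move=> Uu; apply/row_matrixP => i; rewrite rowE -(deriveEjacobian _ (dX Uu)).
by apply/rowP => a; rewrite !mxE.
Qed.

Lemma metric_tangent_mx u : metric X u = tangent_mx u *m (tangent_mx u)^T.
Proof.
by apply/matrixP => i j; rewrite !mxE; apply: eq_bigr => a _; rewrite !mxE.
Qed.

(** A row vector [v] killed by the Gram matrix of the tangent vectors satisfies [|v J|^2 = 0], so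
    [v J = 0], and regularity of the chart forces [v = 0]. *)
Lemma metric_unit u : U u -> metric X u \in unitmx.
Proof.
move=> Uu; rewrite metric_tangent_mx -row_free_unit; apply: inj_row_free => v.
rewrite mulmxA => vJ; apply/eqP.
rewrite -(mulmx_free_eq0 _ (chart_regular X_chart Uu)) jacobianE//.
by rewrite -dot_eq0 dotE trmx_mul mulmxA vJ mul0mx mxE.
Qed.

Lemma dot_gradient_partial i u : U u ->
  dot (gradient psi (X u)) (partial i X u) = 0.
Proof.
move=> Uu; have dpsi : differentiable psi (X u) by case: psi_C3 => d _; exact/d/D_X.
have H := is_derive_comp_gradient (delta_mx 0 i) (dX Uu) dpsi.
refine (etrans (esym (@derive_val _ _ _ _ _ _ _ H)) _).
apply: derive_val; apply: (is_derive_eq_on U_open Uu _ (is_derive_cst c _ _)).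
by move=> y Uy; exact: (chart_level X_chart Uy).
Qed.

Definition hessian (x : 'rV[R]_n.+1) : 'M[R]_n.+1 :=
  \matrix_(a, b) partial a (partial b psi) x.

(** Obtained by differentiating the tangency relation [dot_gradient_partial] along the chart. *)
Lemma dot_gradient_partial2 i j u : U u ->
  dot (gradient psi (X u)) (partial i (partial j X) u)
  = - (tangent_mx u *m hessian (X u) *m (tangent_mx u)^T) i j.
Proof.
move=> Uu; apply/eqP; rewrite -addr_eq0 addrC; apply/eqP.
have HA : is_derive u (delta_mx 0 i) (fun v => gradient psi (X v))
    (\row_a dot (gradient (partial a psi) (X u)) (partial i X u)).
  apply: is_derive_mx => z a; rewrite ord1 mxE.
  have d2 : differentiable (partial a psi) (X u).
    by case: psi_C3 => _ /(_ a) [d _]; exact/d/D_X.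
  have H := is_derive_comp_gradient (delta_mx 0 i) (dX Uu) d2.
  by apply: (is_derive_eq_on U_open Uu _ H) => y Uy; rewrite mxE.
have H := is_derive_dot HA (tangentD i j Uu).
have H0 := is_derive_eq_on U_open Uu (fun y Uy => dot_gradient_partial j Uy)
  (is_derive_cst 0 _ (delta_mx 0 i)).
refine (etrans (congr1 (+%R^~ _) _)
  (etrans (esym (@derive_val _ _ _ _ _ _ _ H)) (@derive_val _ _ _ _ _ _ _ H0))).
rewrite mxE; apply: eq_bigr => a _; rewrite !mxE; congr (_ * _).
by apply: eq_bigr => b _; rewrite !mxE mulrC.
Qed.

Variables (u : 'rV[R]_n).
Hypothesis Uu : U u.
Let N : 'rV[R]_n.+1 := unit_normal psi (X u).
Let J := tangent_mx u.
Let F := enorm (gradient psi (X u)).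

Let Q_gt0 : 0 < sqgrad psi (X u).
Proof. exact: (sqgrad_gt0 psi_regular (D_X Uu)). Qed.

Let F2 : F ^+ 2 = sqgrad psi (X u).
Proof. exact: sqr_enorm_gradient. Qed.

Let unit_normalE : N = - F^-1 *: gradient psi (X u).
Proof. by []. Qed.

Let F_neq0 : F != 0.
Proof. by have := lt0r_neq0 Q_gt0; rewrite -F2 sqrf_eq0. Qed.

Let normal_unit : N *m N^T = 1%:M.
Proof.
rewrite [LHS]mx11_scalar; congr (_ %:M).
rewrite -dotE unit_normalE dotZl dotZr -/(sqgrad psi (X u)) -F2.
by field.
Qed.

Let normal_tangent i : dot (partial i X u) N = 0.
Proof. by rewrite unit_normalE dotZr dotC dot_gradient_partial// mulr0. Qed.

Let frameE : J^T *m inv_metric X u *m J + N^T *m N = 1%:M.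
Proof.
rewrite /inv_metric metric_tangent_mx; apply: adapted_frame => //.
  by rewrite -metric_tangent_mx metric_unit.
apply/matrixP => i z; rewrite !ord1 [RHS]mxE -[RHS](normal_tangent i) dotE !mxE.
by apply: eq_bigr => a _; rewrite mxE.
Qed.

(** The resolution of the identity [frameE] is inserted between [v] and [w]. *)
Let frame (v w : 'rV[R]_n.+1) : dot v w =
  \sum_p dot v (partial p X u) * dot (dual_tangent X p u) w + dot v N * dot N w.
Proof.
rewrite [LHS]dotE -[v in LHS]mulmx1 -frameE mulmxDr mulmxDl mxE; congr (_ + _).
  rewrite -!mulmxA mulmxA mxE; apply: eq_bigr => p _; congr (_ * _).
    by rewrite mxE; apply: eq_bigr => a _; rewrite !mxE.
  rewrite mxE dot_suml; apply: eq_bigr => k _; rewrite dotZl; congr (_ * _).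
  by rewrite mxE; apply: eq_bigr => a _; rewrite !mxE.
rewrite !dotE mulmxA -mulmxA mxE big_ord1 //.
Qed.

(** The minus sign in [unit_normal] cancels the one in [dot_gradient_partial2]. *)
Let second_formE : second_form X N u = F^-1 *: (J *m hessian (X u) *m J^T).
Proof.
apply/matrixP => i j; rewrite [LHS]mxE [RHS]mxE dotC unit_normalE dotZl.
by rewrite dot_gradient_partial2// mulrNN.
Qed.

Let inv_second :
  inv_metric X u *m second_form X N u
  = F^-1 *: (inv_metric X u *m (J *m hessian (X u) *m J^T)).
Proof. by rewrite second_formE -scalemxAr. Qed.

Lemma normal_hessian : (N *m hessian (X u) *m N^T) 0 0
  = (\sum_a partial a psi (X u) * hess_grad psi a (X u)) / sqgrad psi (X u).
Proof.
rewrite unit_normalE linearZ /= -!scalemxAl -scalemxAr -mulmxA 2!mxE.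
rewrite -F2 [RHS]mulrC mulrA mulrNN -expr2 exprVn; congr (_ * _).
rewrite mxE; apply: eq_bigr => a _; rewrite !mxE; congr (_ * _).
by apply: eq_bigr => b _; rewrite !mxE mulrC.
Qed.

Lemma normal_hessian2 : (N *m hessian (X u) *m hessian (X u) *m N^T) 0 0
  = (\sum_a hess_grad psi a (X u) ^+ 2) / sqgrad psi (X u).
Proof.
rewrite unit_normalE linearZ /= -!scalemxAl -scalemxAr.
rewrite -[_ *m (gradient psi (X u))^T]mulmxA 2!mxE.
rewrite -F2 [RHS]mulrC mulrA mulrNN -expr2 exprVn; congr (_ * _).
rewrite mxE; apply: eq_bigr => a _; rewrite expr2 !mxE; congr (_ * _).
  apply: eq_bigr => b _; rewrite !mxE; apply: (congr1 ( *%R _)).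
  apply: (hessianC D_open psi_C3); exact: D_X.
by apply: eq_bigr => b _; rewrite !mxE mulrC.
Qed.

(** The trace of the Hessian on the tangent space is the Laplacian minus the normal entry given by
    [normal_hessian]. *)
Lemma trace_weingarten : \tr (weingarten X N u) =
  (laplacian psi (X u)
   - (\sum_a partial a psi (X u) * hess_grad psi a (X u)) / sqgrad psi (X u)) / F.
Proof.
rewrite weingartenE mxtrace_tr inv_second linearZ /= (trace_compression _ frameE).
rewrite normal_hessian mulrC laplacianE; congr ((_ - _) / _).
by apply: eq_bigr => a _; rewrite mxE.
Qed.

(** Both traces in [gauss_equation] are computed by compression of the Hessian. The square of its
    normal entry occurs in each and would cancel on expansion. *)
Lemma ricci_scalar_level_set : ricci_scalar X u =
  ((laplacian psi (X u)
     - (\sum_a partial a psi (X u) * hess_grad psi a (X u)) / sqgrad psi (X u)) ^+ 2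
   - (\sum_a \sum_b partial a (partial b psi) (X u) ^+ 2
      - 2 * ((\sum_a hess_grad psi a (X u) ^+ 2) / sqgrad psi (X u))
      + ((\sum_a partial a psi (X u) * hess_grad psi a (X u)) / sqgrad psi (X u)) ^+ 2))
  / sqgrad psi (X u).
Proof.
rewrite (gauss_equation U_open X_C3 metric_unit Uu normal_tangent frame).
rewrite trace_weingarten weingartenE -trmx_mul mxtrace_tr inv_second.
rewrite -scalemxAl -scalemxAr scalerA [\tr (_ *: _)]linearZ /=
  (trace_compression2 _ frameE).
rewrite normal_hessian normal_hessian2.
have -> : \tr (hessian (X u) *m hessian (X u))
    = \sum_a \sum_b partial a (partial b psi) (X u) ^+ 2.
  apply: eq_bigr => a _; rewrite mxE; apply: eq_bigr => b _; rewrite !mxE expr2.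
  by apply: (congr1 ( *%R _)); apply: (hessianC D_open psi_C3); exact: D_X.
move: F_neq0; rewrite -F2.
move: (\sum_a _) (\sum_a _) (laplacian _ _) => s1 s2 s3 F0.
set s4 := \sum_a _; move: s4 => s4; by field.
Qed.

End LevelSetChart.

Theorem proposition1p4 (R : realType) (n : nat)
    (D : set 'rV[R]_n.+1) (psi : 'rV[R]_n.+1 -> R)
    (D_open : open D) (D_connected : connected D)
    (psi_C3 : classC 3 D psi)
    (psi_regular : forall x, D x -> gradient psi x != 0)
    (r : 'rV[R]_n.+1) (Dr : D r)
    (U : set 'rV[R]_n) (X : 'rV[R]_n -> 'rV[R]_n.+1) (u : 'rV[R]_n)
    (X_chart : level_set_chart D psi (psi r) U X) (Uu : U u) (Xu : X u = r) :
  let F := fun x => enorm (gradient psi x) in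
  let V := laplacian psi in
  let Rs := ricci_scalar X u in
  let W := weingarten X (unit_normal psi r) u in
  let E1 := laplacian (fun x => ln (F x)) r + Rs - dpsi psi V r
            - 2 * \tr W * V r / F r + V r ^+ 2 / F r ^+ 2 in
  let E2 := laplacian (fun x => ln (F x)) r + Rs
            - F r ^+ 2 * dpsi psi (fun x => V x / F x ^+ 2) r
            - V r ^+ 2 / F r ^+ 2 in
  let E3 := laplacian (fun x => ln (F x)) r + Rs
            - divergence (fun x => (V x / F x ^+ 2) *: gradient psi x) r in
  [/\ E1 = E2, E2 = E3 & E3 = 0].
Proof.
move=> F V Rs W E1 E2 E3; subst r.
have F2 : F (X u) ^+ 2 = sqgrad psi (X u) by exact: sqr_enorm_gradient.
have F0 : F (X u) != 0.
  by rewrite -(@sqrf_eq0 R) F2; apply/lt0r_neq0/(sqgrad_gt0 psi_regular Dr).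
have EdV : dpsi psi V (X u)
    = dot (gradient psi (X u)) (gradient V (X u)) / F (X u) ^+ 2.
  by rewrite /dpsi mulrC.
have EL := laplacian_log_enorm D_open psi_C3 psi_regular Dr.
have EdQ := dpsi_laplacian_sqgrad D_open psi_C3 psi_regular Dr.
have Ediv := divergence_laplacian_sqgrad D_open psi_C3 psi_regular Dr.
have EW := trace_weingarten psi_C3 psi_regular X_chart Uu.
have ER := ricci_scalar_level_set D_open psi_C3 psi_regular X_chart Uu.
rewrite /E1 /E2 /E3 /Rs /W EdV EL EdQ Ediv EW ER -/V -/(F (X u)) -F2.
move: F0; move: (F (X u)) (V (X u)) (dot _ _) => f v w f0.
move: (\sum_i \sum_k partial i (partial k psi) (X u) ^+ 2).
move: (\sum_i hess_grad psi i (X u) ^+ 2) 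
  (\sum_i partial i psi (X u) * hess_grad psi i (X u)) => s1 s2 s3.
(* All sums are now real atoms and [f] is nonzero. The first equality comes down to the value of the
   trace of the Weingarten transform, the second to the product rule for the divergence. In the
   third, the terms in the gradient of the Laplacian cancel and the scalar curvature offsets the
   rest. *)
by split; field.
Qed.
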